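(* Let $k,m>0$, and let $q_0\neq0$ satisfy $1+4k=4q_0$. Consider the Sturm-Liouville problem in Liouville normal form $$\text{(N)}\qquad -\frac{d^2v}{dt^2}+\frac{k}{(t+m)^2}v=\lambda v,\quad 0<t<\pi,\qquad v(0)=0=v(\pi),$$ with constant potential function $q=q_0$ and density function $r=\tau^2$, where $\tau=t+m$. Then for every $x_0\in\mathbb R$, (N) admits the canonical form $$-\frac{d}{dx}\left\{\big[3(x+x_0)\big]^{4/3}\frac{du}{dx}\right\}+q_0\,u=\lambda\,e^{2[3(x+x_0)]^{1/3}}\,u,\qquad a<x<b,$$ with Dirichlet boundary conditions $u(a)=0=u(b)$, where $$a=-x_0+\tfrac13\ln^3m,\qquad b=-x_0+\tfrac13\ln^3(\pi+m),$$ $$\delta_0=m\ln^2m,\qquad \gamma_0=(\pi+m)\ln^2(\pi+m).$$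
   Context: Here $y^{1/3}$ is the real cube root and $y^{4/3}=(y^{1/3})^4$. A canonical form is a problem $-(p\,u')'+q\,u=\lambda r\,u$ on $a<x<b$ with boundary conditions $\delta_0u(a)-\delta_1p(a)u'(a)=0$, $\gamma_0u(b)-\gamma_1p(b)u'(b)=0$; here $\delta_1=\gamma_1=0$. We say that (N) admits this canonical form if the two are related by Liouville's transformation: there is a change of variable $t\mapsto x(t)$ from $[0,\pi]$ onto $[a,b]$ with $dx/dt=\sqrt{p/r}$, and a real function $\overline\omega=1/w$ with $\overline\omega^{\,4}=pr$ (in this theorem $\overline\omega=\sqrt\tau\,\ln\tau$) such that $$\frac{k}{(t+m)^2}=\frac qr+w\frac{d^2}{dt^2}\left(\frac1w\right),$$ and $u=wv$ turns (N) into the canonical problem. These relations are understood at the points where $\overline\omega\neq0$. The boundary coefficients are given by $\delta_0=\overline\omega^2$ at $x=a$ and $\gamma_0=\overline\omega^2$ at $x=b$.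
   Formalization: When m=1 one has δ_0=0 and the weight vanishes at t=0, so u(a)=0 fails there (u=wv tends to v'(0)); the conditions at the left end point, v(0)=0 and u(a)=0, are therefore claimed only for m≠1. *)

(* Defs.v *)
From Stdlib Require Import Reals Lra.
From Coquelicot Require Import Coquelicot.
Open Scope R_scope.

(** Real cube root.  The factor [sign y] gives [cbrt 0 = 0] although
    [Rpower 0 _ = 1]. *)
Definition cbrt (y : R) : R := sign y * Rpower (Rabs y) (/ 3).

Lemma cbrt_cube (y : R) : cbrt y ^ 3 = y.
Proof.
  unfold cbrt. rewrite Rpow_mult_distr.
  destruct (Req_dec y 0) as [->|Hy].
  - rewrite sign_0. ring.
  - assert (Ha : 0 < Rabs y) by (apply Rabs_pos_lt; exact Hy).
    assert (E : Rpower (Rabs y) (/ 3) ^ 3 = Rabs y).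
    { rewrite <- Rpower_pow by (unfold Rpower; apply exp_pos).
      rewrite Rpower_mult.
      replace (/ 3 * INR 3) with 1 by (simpl; field).
      apply Rpower_1, Ha. }
    rewrite E. destruct (Rlt_or_le 0 y) as [H|H].
    + rewrite (sign_eq_1 _ H), Rabs_pos_eq by lra. ring.
    + rewrite sign_eq_m1, Rabs_left by lra. ring.
Qed.

(** [- (p u')' + q u = lambda r u] on [lo < x < hi], with
    [d0 u(lo) - d1 p(lo) u'(lo) = 0] and [g0 u(hi) - g1 p(hi) u'(hi) = 0]. *)
Record sl_problem : Type := SLProblem {
  sl_lo : R; sl_hi : R;
  sl_p : R -> R; sl_q : R -> R; sl_r : R -> R;
  sl_d0 : R; sl_d1 : R;
  sl_g0 : R; sl_g1 : R }.

(** One-sided derivatives, total in the style of [Derive]. *)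
Definition right_Derive (u : R -> R) (a : R) : R :=
  real (Lim (fun h => (u (a + Rabs h) - u a) / Rabs h) 0).
Definition left_Derive (u : R -> R) (b : R) : R :=
  real (Lim (fun h => (u b - u (b - Rabs h)) / Rabs h) 0).

Definition sl_equation_at (P : sl_problem) (lambda : R) (u : R -> R) (x : R)
  : Prop :=
  locally x (fun y => ex_derive u y) /\
  ex_derive (fun y => sl_p P y * Derive u y) x /\
  - Derive (fun y => sl_p P y * Derive u y) x + sl_q P x * u x
    = lambda * sl_r P x * u x.

Definition sl_bc_lo (P : sl_problem) (u : R -> R) : Prop :=
  sl_d0 P * u (sl_lo P)
  - sl_d1 P * (sl_p P (sl_lo P) * right_Derive u (sl_lo P)) = 0.
Definition sl_bc_hi (P : sl_problem) (u : R -> R) : Prop :=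
  sl_g0 P * u (sl_hi P)
  - sl_g1 P * (sl_p P (sl_hi P) * left_Derive u (sl_hi P)) = 0.

(** Classical solution of [P], all conditions being required only at the points
    of [S]; with [S] everything, the usual notion of solution. *)
Definition sl_solves_on (S : R -> Prop) (P : sl_problem) (lambda : R)
    (u : R -> R) : Prop :=
  (forall x, sl_lo P <= x <= sl_hi P -> S x ->
     filterlim u (within (fun y => sl_lo P <= y <= sl_hi P) (locally x))
       (locally (u x))) /\
  (forall x, sl_lo P < x < sl_hi P -> S x -> sl_equation_at P lambda u x) /\
  (S (sl_lo P) -> sl_bc_lo P u) /\
  (S (sl_hi P) -> sl_bc_hi P u).

(** [- v'' + Q v = lambda v] on [0 < t < PI], [v(0) = 0 = v(PI)]. *)
Definition liouville_normal_form (Q : R -> R) : sl_problem :=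
  SLProblem 0 PI (fun _ => 1) Q (fun _ => 1) 1 0 1 0.

(** The canonical form [C] and the Dirichlet normal form with potential [Q] are
    related by Liouville's transformation with change of variable [x] and
    [wbar = 1/w].  The functions [x] and [wbar] are total, so regularity on the
    closed interval is expressed by two-sided derivatives of an extension.
    What involves [w] is required only where [wbar] does not vanish. *)
Definition liouville_related (Q : R -> R) (C : sl_problem) (x wbar : R -> R)
  : Prop :=
  let w := fun t => / wbar t in
  let reg := fun t => wbar t <> 0 in
  let xreg := fun y => exists t, 0 <= t <= PI /\ reg t /\ x t = y in
  (x 0 = sl_lo C /\ x PI = sl_hi C /\
   (forall s t, 0 <= s -> s < t -> t <= PI -> x s < x t) /\
   (forall y, sl_lo C <= y <= sl_hi C -> exists t, 0 <= t <= PI /\ x t = y) /\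
   (forall t, 0 <= t <= PI ->
      is_derive x t (sqrt (sl_p C (x t) / sl_r C (x t))))) /\
  (forall t, 0 <= t <= PI -> wbar t ^ 4 = sl_p C (x t) * sl_r C (x t)) /\
  (forall t, 0 <= t <= PI -> reg t ->
     locally t (fun s => ex_derive wbar s) /\
     ex_derive (Derive wbar) t /\
     Q t = sl_q C (x t) / sl_r C (x t) + w t * Derive_n wbar 2 t) /\
  (forall (lambda : R) (v u : R -> R),
     (forall t, 0 <= t <= PI -> reg t -> u (x t) = w t * v t) ->
     (sl_solves_on reg (liouville_normal_form Q) lambda v <->
      sl_solves_on xreg C lambda u)) /\
  (sl_d0 C = wbar 0 ^ 2 /\ sl_d1 C = 0 /\
   sl_g0 C = wbar PI ^ 2 /\ sl_g1 C = 0).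

(* Main.v *)
(** With [c = cbrt (3 (x + x0))], the change of variable is [c = ln (t + m)], so
    [p = c^4], [r = exp (2 c)] and [dx/dt = c^2 / exp c], and every relation
    becomes an identity in [c] and [exp c].  The substitution [v = wbar * (u o x)]
    pulls a solution back along [x] as soon as
    [p_A x' wbar^2 = p_B o x], [r_A wbar^2 = (r_B o x) x'] and
    [q_A wbar^2 = (p_A wbar')' wbar + (q_B o x) x'], because then
    [p_A v' = (p_A wbar') (u o x) + (p_B u' o x) / wbar].  These relations hold for
    an arbitrary leading coefficient [p_A], so the same pullback along the inverse
    [t = exp c - m], with weight [1 / wbar = exp (- c / 2) / c], gives the converse.
    The point [t + m = 1], where [wbar] vanishes and [x' = 0], is excluded on both
    sides. *)
Require Import Defs.
From Stdlib Require Import Reals Lra.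
From Coquelicot Require Import Coquelicot.
Open Scope R_scope.

(* The equation may be typed in one of the structures that Coquelicot puts on
   [R], where [ring] and [field] do not recognize it. *)
Ltac eq_in_R := match goal with |- ?a = ?b => change (@eq R a b) end.

(** * Pulling solutions back along a change of variable with a weight *)

(** The first-order relations are assumed near [t], since they serve to rewrite the flux of [v]
    before it is differentiated; the second-order ones enter only at [t]. *)
Lemma sl_equation_at_pullback (A B : sl_problem) (x dx wbar dwbar : R -> R)
    (ddwbar lambda t : R) (u v : R -> R) :
  locally t (fun s => is_derive x s (dx s) /\ is_derive wbar s (dwbar s) /\
    wbar s <> 0 /\ sl_p A s * dx s * wbar s ^ 2 = sl_p B (x s) /\
    v s = wbar s * u (x s)) ->
  is_derive (fun s => sl_p A s * dwbar s) t ddwbar ->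
  sl_q A t * wbar t ^ 2 = ddwbar * wbar t + sl_q B (x t) * dx t ->
  sl_r A t * wbar t ^ 2 = sl_r B (x t) * dx t ->
  sl_equation_at B lambda u (x t) -> sl_equation_at A lambda v t.
Proof.
  intros Hloc Hdd Hq Hr (Hu & Hpu & Heq).
  destruct (locally_singleton _ _ Hloc) as (Hx & Hw & Hw0 & Hp & Hv).
  assert (Hux : locally t (fun s => ex_derive u (x s))).
  { apply (ex_derive_continuous x t); [exists (dx t); exact Hx | exact Hu]. }
  assert (Hdv : locally t (fun s =>
      is_derive v s (dwbar s * u (x s) + wbar s * (dx s * Derive u (x s))))).
  { generalize (filter_and _ _ (locally_locally _ _ Hloc) Hux).
    apply filter_imp. intros s [Hs Hus].
    destruct (locally_singleton _ _ Hs) as (Hxs & Hws & _).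
    apply (is_derive_ext_loc (fun s => wbar s * u (x s))).
    - revert Hs; apply filter_imp; intros z Hz; symmetry; apply Hz.
    - apply (is_derive_mult wbar (fun s => u (x s)) s _ _ Hws).
      + apply (is_derive_comp u x); [apply Derive_correct, Hus | exact Hxs].
      + intros; apply Rmult_comm. }
  set (pu := fun y => sl_p B y * Derive u y).
  assert (Hdpv : is_derive (fun s => sl_p A s * Derive v s) t
      (ddwbar * u (x t) + dx t * Derive pu (x t) / wbar t)).
  { apply (is_derive_ext_loc
      (fun s => (sl_p A s * dwbar s) * u (x s) + pu (x s) * / wbar s)).
    - generalize (filter_and _ _ Hloc Hdv).
      apply filter_imp; intros s [(_ & _ & Hs0 & Hps & _) Hvs].
      rewrite (is_derive_unique _ _ _ Hvs). unfold pu. rewrite <- Hps.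
      eq_in_R.
      field. exact Hs0.
    - assert (H1 : is_derive (fun s => u (x s)) t (dx t * Derive u (x t))).
      { apply (is_derive_comp u x); [|exact Hx].
        apply Derive_correct, (locally_singleton _ _ Hu). }
      assert (H2 : is_derive (fun s => pu (x s)) t (dx t * Derive pu (x t))).
      { apply (is_derive_comp pu x); [apply Derive_correct, Hpu | exact Hx]. }
      generalize (is_derive_plus _ _ _ _ _
        (is_derive_mult _ _ _ _ _ Hdd H1 Rmult_comm)
        (is_derive_mult _ _ _ _ _ H2 (is_derive_inv _ _ _ Hw Hw0) Rmult_comm)).
      unfold plus, mult; simpl.
      match goal with |- is_derive _ _ ?a -> is_derive _ _ ?b =>
        replace a with b; [exact (fun H => H)|] end.
      (* The two terms in u'(x t), namely p_A wbar' x' u' and - p_B u' wbar' / wbar^2, cancel by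
         [Hp]. *)
      unfold pu at 3. rewrite <- Hp. field. exact Hw0. }
  split; [|split].
  - revert Hdv; apply filter_imp; intros s Hs; eexists; exact Hs.
  - eexists; exact Hdpv.
  - assert (E : Derive (fun s => sl_p A s * Derive v s) t =
      ddwbar * u (x t) + dx t * Derive pu (x t) / wbar t)
      by exact (is_derive_unique _ _ _ Hdpv).
    rewrite E, Hv.
    change (Derive (fun y => sl_p B y * Derive u y) (x t))
      with (Derive pu (x t)) in Heq.
    apply (Rmult_eq_reg_r (wbar t)); [|exact Hw0].
    replace (Derive pu (x t)) with
      (sl_q B (x t) * u (x t) - lambda * sl_r B (x t) * u (x t)) by lra.
    transitivity (- ddwbar * wbar t * u (x t)
      - dx t * (sl_q B (x t) * u (x t) - lambda * sl_r B (x t) * u (x t))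
      + (sl_q A t * wbar t ^ 2) * u (x t)); [field; exact Hw0|].
    transitivity (lambda * (sl_r A t * wbar t ^ 2) * u (x t)); [|ring].
    rewrite Hq, Hr. ring.
Qed.

(** Relative openness of [SA] turns pointwise data on [SA] into the local data of the previous
    lemma. The boundary conditions are Dirichlet: a nonzero coefficient in [B] forces [u], hence
    [wbar * u], to vanish at the endpoint. *)
Lemma sl_solves_on_pullback (A B : sl_problem) (SA SB : R -> Prop)
    (x dx wbar dwbar ddwbar : R -> R) (lambda : R) (u v : R -> R) :
  x (sl_lo A) = sl_lo B -> x (sl_hi A) = sl_hi B -> sl_lo A <= sl_hi A ->
  (forall t, sl_lo A < t < sl_hi A -> sl_lo B < x t < sl_hi B) ->
  (forall t, sl_lo A <= t <= sl_hi A -> SA t ->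
     within (fun s => sl_lo A <= s <= sl_hi A) (locally t) SA /\ SB (x t)) ->
  (forall t, sl_lo A <= t <= sl_hi A -> SA t ->
     is_derive x t (dx t) /\ is_derive wbar t (dwbar t) /\ wbar t <> 0 /\
     sl_p A t * dx t * wbar t ^ 2 = sl_p B (x t) /\
     v t = wbar t * u (x t)) ->
  (forall t, sl_lo A < t < sl_hi A -> SA t ->
     is_derive (fun s => sl_p A s * dwbar s) t (ddwbar t) /\
     sl_q A t * wbar t ^ 2 = ddwbar t * wbar t + sl_q B (x t) * dx t /\
     sl_r A t * wbar t ^ 2 = sl_r B (x t) * dx t) ->
  sl_d1 A = 0 -> sl_d1 B = 0 -> (SA (sl_lo A) -> sl_d0 B <> 0) ->
  sl_g1 A = 0 -> sl_g1 B = 0 -> (SA (sl_hi A) -> sl_g0 B <> 0) ->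
  sl_solves_on SB B lambda u -> sl_solves_on SA A lambda v.
Proof.
  intros Hlo Hhi Hle Hint HS Hder Heq Ad1 Bd1 Bd0 Ag1 Bg1 Bg0 (Uc & Ue & Ul & Uh).
  assert (Hran : forall t, sl_lo A <= t <= sl_hi A ->
                           sl_lo B <= x t <= sl_hi B).
  { intros t Ht.
    (* The order of the endpoints of [B] is read off from the image of the midpoint of [A], or from
       [Hlo] and [Hhi] if [A] is a single point. *)
    assert (HB : sl_lo B <= sl_hi B).
    { destruct (Rle_lt_or_eq_dec _ _ Hle) as [H|H].
      - specialize (Hint ((sl_lo A + sl_hi A) / 2) ltac:(lra)). lra.
      - rewrite <- Hlo, <- Hhi, H. lra. }
    destruct (Req_dec t (sl_lo A)) as [->|H1]; [lra|].
    destruct (Req_dec t (sl_hi A)) as [->|H2]; [lra|].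
    specialize (Hint t ltac:(lra)). lra. }
  split; [|split; [|split]].
  - intros t Ht St.
    destruct (HS t Ht St) as [Sloc SBt].
    destruct (Hder t Ht St) as (Hx & Hw & Hw0 & Hp & Hv).
    rewrite Hv.
    apply (filterlim_ext_loc (fun s => wbar s * u (x s))).
    { unfold within in Sloc |- *. revert Sloc; apply filter_imp.
      intros s Hs Hs'. symmetry. apply (Hder s Hs' (Hs Hs')). }
    apply (filterlim_comp_2 wbar (fun s => u (x s)) Rmult
      (G := locally (wbar t)) (H := locally (u (x t)))).
    + apply (filterlim_filter_le_1 _ (filter_le_within _)).
      apply (ex_derive_continuous wbar t). eexists; exact Hw.
    (* [u] is continuous only relative to the closed interval of [B]; [Hran] keeps [x] inside it. *)
    + apply (filterlim_comp _ _ _ x u _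
        (within (fun y => sl_lo B <= y <= sl_hi B) (locally (x t)))).
      * intros P HP. unfold within, filtermap in HP |- *.
        assert (Hc : continuous x t)
          by (apply (ex_derive_continuous x t); eexists; exact Hx).
        generalize (Hc _ HP). unfold filtermap. apply filter_imp. auto.
      * apply Uc; auto.
    + apply (filterlim_mult (K := R_AbsRing) (wbar t) (u (x t))).
  - intros t Ht St.
    destruct (HS t ltac:(lra) St) as [Sloc SBt]. unfold within in Sloc.
    destruct (Heq t Ht St) as (Hdd & Hq & Hr).
    apply (sl_equation_at_pullback A B x dx wbar dwbar (ddwbar t) lambda t u v);
      try assumption.
    + assert (Hl : locally t (fun s => sl_lo A < s < sl_hi A)).
      { apply (open_and _ _ (open_gt _) (open_lt _)). exact Ht. }
      generalize (filter_and _ _ Sloc Hl). apply filter_imp.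
      intros s [Hs Hs']. apply Hder; [lra | apply Hs; lra].
    + apply Ue; auto.
  - intros S0. assert (Hr : sl_lo A <= sl_lo A <= sl_hi A) by lra.
    destruct (HS _ Hr S0) as [_ SB0]. rewrite Hlo in SB0.
    destruct (Hder _ Hr S0) as (_ & _ & _ & _ & Hv).
    specialize (Ul SB0). unfold sl_bc_lo in *.
    rewrite Bd1 in Ul. rewrite Ad1, Hv, Hlo.
    destruct (Rmult_integral (sl_d0 B) (u (sl_lo B)) ltac:(lra)) as [H|H].
    + destruct (Bd0 S0 H).
    + rewrite H. ring.
  - intros S0. assert (Hr : sl_lo A <= sl_hi A <= sl_hi A) by lra.
    destruct (HS _ Hr S0) as [_ SB0]. rewrite Hhi in SB0.
    destruct (Hder _ Hr S0) as (_ & _ & _ & _ & Hv).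
    specialize (Uh SB0). unfold sl_bc_hi in *.
    rewrite Bg1 in Uh. rewrite Ag1, Hv, Hhi.
    destruct (Rmult_integral (sl_g0 B) (u (sl_hi B)) ltac:(lra)) as [H|H].
    + destruct (Bg0 S0 H).
    + rewrite H. ring.
Qed.

(** * Inverse and derivative of the real cube root *)

Lemma cube_lt (a b : R) : a < b -> a ^ 3 < b ^ 3.
Proof.
  intros H.
  (* This is twice a^2 + a b + b^2, the cofactor of b - a in b^3 - a^3. *)
  assert (H1 : 0 < (a + b) ^ 2 + a ^ 2 + b ^ 2).
  { destruct (Req_dec a 0) as [->|Ha]; [nra|].
    assert (H1 := pow2_gt_0 a Ha). assert (H2 := pow2_ge_0 b).
    assert (H3 := pow2_ge_0 (a + b)). lra. }
  assert (H2 := Rmult_lt_0_compat (b - a) _ ltac:(lra) H1). nra.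
Qed.

Lemma cube_inj (a b : R) : a ^ 3 = b ^ 3 -> a = b.
Proof.
  intros H. destruct (Rtotal_order a b) as [Hl|[He|Hl]]; [|assumption|];
    apply cube_lt in Hl; lra.
Qed.

Lemma cbrt_of_cube (a : R) : cbrt (a ^ 3) = a.
Proof. apply cube_inj, cbrt_cube. Qed.

Lemma is_derive_cbrt (y : R) : y <> 0 -> is_derive cbrt y (/ (3 * cbrt y ^ 2)).
Proof.
  intros Hy.
  assert (Hc : cbrt y <> 0).
  { intros H. apply Hy. rewrite <- (cbrt_cube y), H. ring. }
  (* In this form the derivative is what differentiating ± exp (ln |y| / 3) produces on each side of
     0. *)
  assert (E : / (3 * cbrt y ^ 2) = cbrt y / (3 * y)).
  { rewrite <- (cbrt_cube y) at 3. field. exact Hc. }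
  rewrite E. clear Hc E. unfold cbrt, Rpower.
  destruct (Rlt_or_le 0 y) as [H|H].
  - apply (is_derive_ext_loc (fun z => exp (/ 3 * ln z))).
    { apply (filter_imp (fun z => 0 < z)); [|apply (open_gt 0), H].
      intros z Hz. rewrite (sign_eq_1 _ Hz), Rabs_pos_eq by lra. eq_in_R. ring. }
    rewrite (sign_eq_1 _ H), Rabs_pos_eq by lra.
    auto_derive; [exact H|]. field. lra.
  - apply (is_derive_ext_loc (fun z => - exp (/ 3 * ln (- z)))).
    { apply (filter_imp (fun z => z < 0)); [|apply (open_lt 0); lra].
      intros z Hz. rewrite sign_eq_m1, Rabs_left by lra. eq_in_R. ring. }
    rewrite sign_eq_m1, Rabs_left by lra.
    auto_derive; [lra|]. field. lra.
Qed.

(** * Derivatives of the weight sqrt(t + m) ln(t + m) *)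

(** Rewriting [t + m] as a square makes the identities below rational in its root, within reach of
    [field]. *)
Lemma sqrt_sqr_pos (a : R) : 0 < a -> 0 < sqrt a /\ a = sqrt a * sqrt a.
Proof.
  intros Ha. split; [apply sqrt_lt_R0, Ha|].
  symmetry. apply sqrt_sqrt. lra.
Qed.

Lemma is_derive_sqrt_ln (m t : R) : 0 < t + m ->
  is_derive (fun s => sqrt (s + m) * ln (s + m)) t
    ((ln (t + m) / 2 + 1) / sqrt (t + m)).
Proof.
  intros Ht. destruct (sqrt_sqr_pos _ Ht) as [Hs E].
  auto_derive; [tauto|].
  replace (1 * / (t + m)) with (/ (sqrt (t + m) * sqrt (t + m)))
    by (rewrite <- E; field; lra).
  field. lra.
Qed.

(** The constants cancel, leaving wbar'' / wbar = - 1 / (4 (t + m)^2) where the logarithm is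
    nonzero; this is the origin of q0 = k + 1/4. *)
Lemma is_derive2_sqrt_ln (m t : R) : 0 < t + m ->
  is_derive (fun s => (ln (s + m) / 2 + 1) / sqrt (s + m)) t
    (- ln (t + m) / (4 * (t + m) * sqrt (t + m))).
Proof.
  intros Ht. destruct (sqrt_sqr_pos _ Ht) as [Hs E].
  auto_derive; [repeat split; lra|].
  replace (1 * / (t + m)) with (/ (sqrt (t + m) * sqrt (t + m)))
    by (rewrite <- E; field; lra).
  replace (4 * (t + m)) with (4 * (sqrt (t + m) * sqrt (t + m)))
    by (rewrite <- E; ring).
  field. lra.
Qed.

(** * The change of variable and its inverse *)

Section CanonicalForm.

Variables (k m q0 x0 : R).
Hypotheses (hm : 0 < m) (hkq : 1 + 4 * k = 4 * q0).

Let C : sl_problem := {|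
  sl_lo := - x0 + / 3 * (ln m) ^ 3;
  sl_hi := - x0 + / 3 * (ln (PI + m)) ^ 3;
  sl_p := fun x => (cbrt (3 * (x + x0))) ^ 4;
  sl_q := fun _ => q0;
  sl_r := fun x => exp (2 * cbrt (3 * (x + x0)));
  sl_d0 := m * (ln m) ^ 2;
  sl_d1 := 0;
  sl_g0 := (PI + m) * (ln (PI + m)) ^ 2;
  sl_g1 := 0 |}.
Let N : sl_problem := liouville_normal_form (fun t => k / (t + m) ^ 2).
Let wbar (t : R) : R := sqrt (t + m) * ln (t + m).
Let x (t : R) : R := - x0 + / 3 * ln (t + m) ^ 3.
Let c (y : R) : R := cbrt (3 * (y + x0)).
Let T (y : R) : R := exp (c y) - m.
Let xreg (y : R) : Prop := exists t, 0 <= t <= PI /\ wbar t <> 0 /\ x t = y.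

Lemma c_x (t : R) : c (x t) = ln (t + m).
Proof.
  unfold c, x. replace (3 * _) with (ln (t + m) ^ 3) by field.
  apply cbrt_of_cube.
Qed.

Lemma c_cube (y : R) : c y ^ 3 = 3 * (y + x0).
Proof. apply cbrt_cube. Qed.

Lemma T_plus_m (y : R) : T y + m = exp (c y).
Proof. unfold T. ring. Qed.

Lemma x_T (y : R) : x (T y) = y.
Proof. unfold x. rewrite T_plus_m, ln_exp, c_cube. field. Qed.

Lemma T_x (t : R) : 0 < t + m -> T (x t) = t.
Proof. intros Ht. unfold T. rewrite c_x, exp_ln by exact Ht. ring. Qed.

Lemma x_lt (s t : R) : 0 < s + m -> s < t -> x s < x t.
Proof.
  intros Hs Hst. unfold x.
  assert (H := cube_lt (ln (s + m)) (ln (t + m)) ltac:(apply ln_increasing; lra)).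
  lra.
Qed.

Lemma x_lt_inv (s t : R) : 0 < t + m -> x s < x t -> s < t.
Proof.
  intros Ht H. destruct (Rlt_or_le s t) as [|[Hl|He]]; [assumption| |].
  - apply x_lt in Hl; lra.
  - subst. lra.
Qed.

Lemma x_0 : x 0 = sl_lo C.
Proof. unfold x, C; simpl. rewrite Rplus_0_l. reflexivity. Qed.

Lemma T_range_open (y : R) : sl_lo C < y < sl_hi C -> 0 < T y < PI.
Proof.
  rewrite <- x_0. change (sl_hi C) with (x PI).
  (* With y = x (T y), the bounds compare values of [x], and monotonicity reflects them to [T y]. *)
  rewrite <- (x_T y) at 1 2. assert (HP := PI_RGT_0).
  intros [H1 H2]. split; apply x_lt_inv; try assumption.
  - rewrite T_plus_m. apply exp_pos.
  - lra.
Qed.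

Lemma T_range (y : R) : sl_lo C <= y <= sl_hi C -> 0 <= T y <= PI.
Proof.
  assert (HP := PI_RGT_0). intros [[H1|H1] [H2|H2]].
  - assert (H := T_range_open y (conj H1 H2)). lra.
  - subst. change (sl_hi C) with (x PI). rewrite T_x; lra.
  - subst. rewrite <- x_0, T_x; lra.
  - subst. rewrite <- x_0, T_x; lra.
Qed.

Lemma sqrt_exp (a : R) : sqrt (exp a) = exp (a / 2).
Proof.
  apply sqrt_lem_1; [left; apply exp_pos | left; apply exp_pos |].
  rewrite <- exp_plus. f_equal. field.
Qed.

Lemma wbar_T (y : R) : wbar (T y) = exp (c y / 2) * c y.
Proof. unfold wbar. rewrite T_plus_m, ln_exp, sqrt_exp. reflexivity. Qed.

Lemma wbar_neq_0 (t : R) : 0 < t + m -> (wbar t <> 0 <-> ln (t + m) <> 0).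
Proof.
  intros Ht. destruct (sqrt_sqr_pos _ Ht) as [Hs _]. unfold wbar. split.
  - intros H H'. apply H. rewrite H'. ring.
  - intros H. apply Rmult_integral_contrapositive_currified; lra.
Qed.

(** Both sides say that [t + m] differs from 1. The right one is visibly an open condition where [c]
    is continuous. *)
Lemma xreg_iff (y : R) : sl_lo C <= y <= sl_hi C -> (xreg y <-> c y <> 0).
Proof.
  intros Hy. split.
  - intros (t & Ht & Hw & <-). rewrite c_x. apply wbar_neq_0; [lra|exact Hw].
  - intros H. exists (T y). split; [apply T_range, Hy|split; [|apply x_T]].
    rewrite wbar_T. assert (He := exp_pos (c y / 2)).
    apply Rmult_integral_contrapositive_currified; lra.
Qed.

Lemma sl_r_x (t : R) : 0 < t + m -> sl_r C (x t) = (t + m) ^ 2.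
Proof.
  intros Ht. change (exp (2 * c (x t)) = (t + m) ^ 2).
  rewrite c_x. replace (2 * ln (t + m)) with (ln (t + m) + ln (t + m)) by ring.
  rewrite exp_plus, exp_ln by exact Ht. ring.
Qed.

Lemma is_derive_x (t : R) : 0 < t + m ->
  is_derive x t (ln (t + m) ^ 2 / (t + m)).
Proof.
  intros Ht. unfold x. auto_derive; [exact Ht|]. field. lra.
Qed.

(** The excluded zero of [c] is the point where the cube root has a vertical tangent. *)
Lemma is_derive_c (y : R) : c y <> 0 -> is_derive c y (/ c y ^ 2).
Proof.
  intros Hc.
  assert (Hy : 3 * (y + x0) <> 0) by (rewrite <- c_cube; apply pow_nonzero, Hc).
  replace (/ c y ^ 2) with (3 * / (3 * c y ^ 2)) by (field; exact Hc).
  apply (is_derive_comp cbrt (fun z => 3 * (z + x0)) y).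
  - apply is_derive_cbrt, Hy.
  - auto_derive; [exact I|ring].
Qed.

(** * Transfer of solutions in both directions *)

Lemma canonical_of_normal (lambda : R) (v u : R -> R) :
  (forall t, 0 <= t <= PI -> wbar t <> 0 -> u (x t) = / wbar t * v t) ->
  sl_solves_on (fun t => wbar t <> 0) N lambda v -> sl_solves_on xreg C lambda u.
Proof.
  intros Huv. assert (HP := PI_RGT_0).
  (* Chain rule through [c]: differentiating in y is differentiating in c and dividing by c^2. *)
  assert (Hd : forall f a y, c y <> 0 -> is_derive f (c y) a ->
      is_derive (fun z => f (c z)) y (/ c y ^ 2 * a)).
  { intros f a y Hc Hf. apply (is_derive_comp f c); [exact Hf|].
    apply is_derive_c, Hc. }
  (* The functions are T, T', the weight W = 1 / (wbar o T), W', and the derivative of the flux c^4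
     W'. *)
  apply (sl_solves_on_pullback C N xreg (fun t => wbar t <> 0) T
    (fun y => exp (c y) / c y ^ 2) (fun y => exp (- c y / 2) / c y)
    (fun y => - exp (- c y / 2) * (c y / 2 + 1) / c y ^ 4)
    (fun y => exp (- c y / 2) / (4 * c y))); try reflexivity.
  - rewrite <- x_0. apply (T_x 0). lra.
  - change (sl_hi C) with (x PI). apply (T_x PI). lra.
  - rewrite <- x_0. left. apply (x_lt 0 PI); lra.
  - intros y Hy. apply T_range_open, Hy.
  - intros y Hy Sy. split.
    + assert (Hc := proj1 (xreg_iff y Hy) Sy).
      assert (Hcont : continuous c y).
      { apply (ex_derive_continuous c y). eexists; apply is_derive_c, Hc. }
      generalize (Hcont _ (open_neq 0 (c y) Hc)). unfold within, filtermap.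
      apply filter_imp. intros z Hz Hz'. apply xreg_iff; assumption.
    + destruct Sy as (t & Ht & Hw & <-). rewrite T_x; [exact Hw|lra].
  - intros y Hy Sy. assert (Hc := proj1 (xreg_iff y Hy) Sy).
    assert (He := exp_pos (- c y / 2)).
    (* All exponentials are reduced to exp (- c / 2), so that [field] sees two independent
       unknowns. *)
    assert (Ee : exp (c y) = / (exp (- c y / 2) * exp (- c y / 2))).
    { rewrite <- exp_plus, <- exp_Ropp. f_equal. field. }
    split; [|split; [|split; [|split]]].
    + unfold T. replace (exp (c y) / c y ^ 2) with (/ c y ^ 2 * exp (c y))
        by (field; exact Hc).
      apply (Hd (fun a => exp a - m)); [exact Hc|].
      auto_derive; [exact I|ring].
    + replace (- exp (- c y / 2) * (c y / 2 + 1) / c y ^ 4) with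
        (/ c y ^ 2 * (- exp (- c y / 2) * (c y / 2 + 1) / c y ^ 2))
        by (field; exact Hc).
      apply (Hd (fun a => exp (- a / 2) / a)); [exact Hc|].
      auto_derive; [exact Hc|]. unfold Rdiv. field. exact Hc.
    + apply Rmult_integral_contrapositive_currified; [lra|].
      apply Rinv_neq_0_compat, Hc.
    + change (c y ^ 4 * (exp (c y) / c y ^ 2) * (exp (- c y / 2) / c y) ^ 2 = 1).
      rewrite Ee. field. split; lra.
    + assert (Hw : wbar (T y) <> 0).
      { destruct Sy as (t & Ht & Hw & <-). rewrite T_x; [exact Hw|lra]. }
      rewrite <- (x_T y) at 1. rewrite (Huv _ (T_range y Hy) Hw).
      rewrite wbar_T. replace (- c y / 2) with (- (c y / 2)) by field.
      rewrite exp_Ropp. field.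
      split; [apply Rgt_not_eq, exp_pos | exact Hc].
  - intros y Hy Sy. assert (Hc := proj1 (xreg_iff y ltac:(lra)) Sy).
    assert (He := exp_pos (- c y / 2)).
    assert (Ee : exp (c y) = / (exp (- c y / 2) * exp (- c y / 2))).
    { rewrite <- exp_plus, <- exp_Ropp. f_equal. field. }
    split; [|split].
    (* The factor p = c^4 cancels the denominator of W', but only where c does not vanish, hence
       locally. *)
    + apply (is_derive_ext_loc (fun z => - exp (- c z / 2) * (c z / 2 + 1))).
      * assert (Hcont : continuous c y).
        { apply (ex_derive_continuous c y). eexists; apply is_derive_c, Hc. }
        generalize (Hcont _ (open_neq 0 (c y) Hc)). unfold filtermap.
        apply filter_imp. intros z Hz. unfold C; simpl. fold (c z).
        field. exact Hz.
      * replace (exp (- c y / 2) / (4 * c y)) with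
          (/ c y ^ 2 * (exp (- c y / 2) * c y / 4)) by (field; exact Hc).
        apply (Hd (fun a => - exp (- a / 2) * (a / 2 + 1))); [exact Hc|].
        auto_derive; [exact I|]. unfold Rdiv. field.
    + change (q0 * (exp (- c y / 2) / c y) ^ 2 =
        exp (- c y / 2) / (4 * c y) * (exp (- c y / 2) / c y)
        + k / (T y + m) ^ 2 * (exp (c y) / c y ^ 2)).
      (* The 1/4 balances the flux derivative of the weight, and [k] the potential of the normal
         form. *)
      replace q0 with (1 / 4 + k) by lra. rewrite T_plus_m, Ee.
      field. split; lra.
    + change (exp (2 * c y) * (exp (- c y / 2) / c y) ^ 2
              = 1 * (exp (c y) / c y ^ 2)).
      replace (2 * c y) with (c y + c y) by ring. rewrite exp_plus, Ee.
      field. split; lra.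
  - intros _. simpl. lra.
  - intros _. simpl. lra.
Qed.

Lemma normal_of_canonical (lambda : R) (v u : R -> R) :
  (forall t, 0 <= t <= PI -> wbar t <> 0 -> u (x t) = / wbar t * v t) ->
  sl_solves_on xreg C lambda u -> sl_solves_on (fun t => wbar t <> 0) N lambda v.
Proof.
  intros Huv. assert (HP := PI_RGT_0).
  apply (sl_solves_on_pullback N C (fun t => wbar t <> 0) xreg x
    (fun t => ln (t + m) ^ 2 / (t + m)) wbar
    (fun t => (ln (t + m) / 2 + 1) / sqrt (t + m))
    (fun t => - ln (t + m) / (4 * (t + m) * sqrt (t + m)))); try reflexivity.
  - exact x_0.
  - simpl; lra.
  - simpl sl_lo at 1; simpl sl_hi at 1. intros t Ht. rewrite <- x_0.
    split; [|change (sl_hi C) with (x PI)]; apply x_lt; lra.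
  - simpl sl_lo; simpl sl_hi. intros t Ht St. split.
    + apply filter_le_within.
      assert (Hc : continuous wbar t).
      { apply (ex_derive_continuous wbar t).
        eexists; apply is_derive_sqrt_ln; lra. }
      exact (Hc _ (open_neq 0 (wbar t) St)).
    + exists t. auto.
  - simpl sl_lo; simpl sl_hi; simpl sl_p at 1. intros t Ht St.
    assert (Htm : 0 < t + m) by lra.
    destruct (sqrt_sqr_pos _ Htm) as [Hs E].
    split; [|split; [|split; [|split]]].
    + apply is_derive_x, Htm.
    + apply is_derive_sqrt_ln, Htm.
    + exact St.
    + change (sl_p C (x t)) with (c (x t) ^ 4). rewrite c_x. unfold wbar.
      rewrite E at 2. field. lra.
    + rewrite Huv by assumption. field. exact St.
  - simpl sl_lo; simpl sl_hi. intros t Ht St.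
    assert (Htm : 0 < t + m) by lra.
    destruct (sqrt_sqr_pos _ Htm) as [Hs E].
    split; [|split].
    + apply (is_derive_ext (fun s => (ln (s + m) / 2 + 1) / sqrt (s + m))).
      * intros s. simpl. rewrite Rmult_1_l. reflexivity.
      * apply is_derive2_sqrt_ln, Htm.
    + change (k / (t + m) ^ 2 * wbar t ^ 2 =
        - ln (t + m) / (4 * (t + m) * sqrt (t + m)) * wbar t
        + q0 * (ln (t + m) ^ 2 / (t + m))).
      replace q0 with (1 / 4 + k) by lra. unfold wbar.
      replace ((sqrt (t + m) * ln (t + m)) ^ 2)
        with ((t + m) * ln (t + m) ^ 2) by (rewrite E at 1; ring).
      field. lra.
    + change (1 * wbar t ^ 2 = sl_r C (x t) * (ln (t + m) ^ 2 / (t + m))).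
      rewrite sl_r_x by exact Htm. unfold wbar.
      replace ((sqrt (t + m) * ln (t + m)) ^ 2)
        with ((t + m) * ln (t + m) ^ 2) by (rewrite E at 1; ring).
      field. lra.
  (* Regularity of the left endpoint means ln m <> 0, which is exactly what makes m ln^2 m
     nonzero. *)
  - simpl sl_lo. intros H. rewrite wbar_neq_0 in H by lra.
    rewrite Rplus_0_l in H. simpl sl_d0.
    apply Rmult_integral_contrapositive_currified; [lra|].
    apply (pow_nonzero _ 2), H.
  - simpl sl_hi. intros H. rewrite wbar_neq_0 in H by lra. simpl sl_g0.
    apply Rmult_integral_contrapositive_currified; [lra|].
    apply (pow_nonzero _ 2), H.
Qed.

(** * The Liouville relations and the boundary coefficients *)

Lemma liouville_related_canonical :
  liouville_related (fun t => k / (t + m) ^ 2) C x wbar.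
Proof.
  assert (HP := PI_RGT_0).
  assert (Hp : forall t, sl_p C (x t) = ln (t + m) ^ 4).
  { intros t. rewrite <- c_x. reflexivity. }
  assert (Hnear : forall t, 0 < t + m -> locally t (fun s => 0 < s + m)).
  { intros t Ht. apply (filter_imp (fun s => - m < s)); [intros; lra|].
    apply (open_gt (- m)). lra. }
  assert (HD : forall t, 0 < t + m ->
      Derive wbar t = (ln (t + m) / 2 + 1) / sqrt (t + m)).
  { intros t Ht. apply is_derive_unique, is_derive_sqrt_ln, Ht. }
  assert (HD2 : forall t, 0 < t + m -> is_derive (Derive wbar) t
      (- ln (t + m) / (4 * (t + m) * sqrt (t + m)))).
  { intros t Ht.
    (* The closed form of [Derive wbar] is available only where [s + m] is positive, so the
       comparison is local. *)
    apply (is_derive_ext_loc (fun s => (ln (s + m) / 2 + 1) / sqrt (s + m))).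
    - generalize (Hnear t Ht). apply filter_imp. intros s Hs. symmetry.
      apply HD, Hs.
    - apply is_derive2_sqrt_ln, Ht. }
  split; [|split; [|split; [|split]]].
  - split; [exact x_0|split; [reflexivity|split; [|split]]].
    + intros s t Hs Hst Ht. apply x_lt; lra.
    + intros y Hy. exists (T y). split; [apply T_range, Hy | apply x_T].
    + intros t Ht. rewrite Hp, sl_r_x by lra.
      (* p / r is a perfect square whose root is nonnegative whatever the sign of the logarithm, so
         sqrt (p / r) is x' itself. *)
      replace (ln (t + m) ^ 4 / (t + m) ^ 2) with
        (Rsqr (ln (t + m) ^ 2 / (t + m))) by (unfold Rsqr; field; lra).
      rewrite sqrt_Rsqr; [apply is_derive_x; lra|].
      apply Rdiv_le_0_compat; [apply pow2_ge_0 | lra].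
  - intros t Ht. rewrite Hp, sl_r_x by lra. unfold wbar.
    destruct (sqrt_sqr_pos (t + m) ltac:(lra)) as [_ E].
    replace ((t + m) ^ 2) with ((sqrt (t + m) * sqrt (t + m)) ^ 2)
      by (rewrite <- E; reflexivity).
    ring.
  - intros t Ht St. assert (Htm : 0 < t + m) by lra.
    split; [|split].
    + generalize (Hnear t Htm). apply filter_imp. intros s Hs.
      eexists; apply is_derive_sqrt_ln, Hs.
    + eexists; apply HD2, Htm.
    + rewrite sl_r_x by exact Htm. simpl Derive_n.
      change (Derive (fun y => Derive (fun y0 => wbar y0) y) t)
        with (Derive (Derive wbar) t).
      rewrite (is_derive_unique _ _ _ (HD2 t Htm)).
      simpl sl_q. replace q0 with (1 / 4 + k) by lra.
      apply wbar_neq_0 in St; [|exact Htm]. unfold wbar.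
      destruct (sqrt_sqr_pos _ Htm) as [Hs E].
      replace (4 * (t + m) * sqrt (t + m)) with
        (4 * sqrt (t + m) * sqrt (t + m) * sqrt (t + m))
        by (rewrite E at 4; ring).
      replace ((t + m) ^ 2) with ((sqrt (t + m) * sqrt (t + m)) ^ 2)
        by (rewrite <- E; reflexivity).
      field. lra.
  - intros lambda v u Huv. split.
    + apply canonical_of_normal, Huv.
    + apply normal_of_canonical, Huv.
  - destruct (sqrt_sqr_pos m hm) as [_ Em].
    destruct (sqrt_sqr_pos (PI + m) ltac:(lra)) as [_ EP].
    unfold wbar; simpl. rewrite Rplus_0_l. repeat split.
    + rewrite Em at 1. ring.
    + rewrite EP at 1. ring.
Qed.

End CanonicalForm.

Theorem theorem4 (k m q0 : R) (hk : 0 < k) (hm : 0 < m) (hq0 : q0 <> 0)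
    (hkq : 1 + 4 * k = 4 * q0) (x0 : R) :
  let C := {|
    sl_lo := - x0 + / 3 * (ln m) ^ 3;
    sl_hi := - x0 + / 3 * (ln (PI + m)) ^ 3;
    sl_p := fun x => (cbrt (3 * (x + x0))) ^ 4;
    sl_q := fun _ => q0;
    sl_r := fun x => exp (2 * cbrt (3 * (x + x0)));
    sl_d0 := m * (ln m) ^ 2;
    sl_d1 := 0;
    sl_g0 := (PI + m) * (ln (PI + m)) ^ 2;
    sl_g1 := 0 |} in
  let wbar := fun t => sqrt (t + m) * ln (t + m) in
  (exists x : R -> R,
     liouville_related (fun t => k / (t + m) ^ 2) C x wbar /\
     (forall t, 0 <= t <= PI -> sl_r C (x t) = (t + m) ^ 2)) /\
  (wbar 0 <> 0 -> forall u : R -> R, sl_bc_lo C u <-> u (sl_lo C) = 0) /\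
  (forall u : R -> R, sl_bc_hi C u <-> u (sl_hi C) = 0).
Proof.
  intros C wbar.
  assert (Hbc : forall d a z, d <> 0 -> (d * a - 0 * z = 0 <-> a = 0)).
  { intros d a z Hd. split.
    - intros H. apply (Rmult_eq_reg_l d); [lra|exact Hd].
    - intros ->. ring. }
  split; [|split].
  - exists (fun t => - x0 + / 3 * ln (t + m) ^ 3). split.
    + apply liouville_related_canonical; assumption.
    + intros t Ht. apply (sl_r_x m q0 x0). lra.
  - intros Hw u. apply Hbc. simpl.
    assert (Hl : ln m <> 0).
    { intros H. apply Hw. unfold wbar. rewrite Rplus_0_l, H. ring. }
    apply Rmult_integral_contrapositive_currified; [lra|].
    apply (pow_nonzero _ 2), Hl.
  - intros u. apply Hbc. simpl. assert (HP := PI_RGT_0).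
    (* As PI > 1, the right coefficient is nonzero for every m > 0, whereas the left one vanishes at
       m = 1. *)
    assert (Hl : 0 < ln (PI + m)).
    { rewrite <- ln_1. apply ln_increasing; [lra|].
      assert (H := PI2_1). lra. }
    apply Rmult_integral_contrapositive_currified; [lra|].
    apply (pow_nonzero _ 2). lra.
Qed.
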